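(* Let $p\in[2,\infty)$ and let $A,B,D\in M_n(\mathbb{C})$. Then: (1) $$w_p\left(\begin{bmatrix}A&0\\0&D\end{bmatrix}\right)\le\frac{1}{2^{\frac2p-1}}\Big(w_p^p(A)+w_p^p(D)\Big)^{1/p},$$ and if $A$ and $D$ are Hermitian, then $$w_p\left(\begin{bmatrix}A&0\\0&D\end{bmatrix}\right)=\Big(w_p^p(A)+w_p^p(D)\Big)^{1/p}.$$ (2) $$w_p\left(\begin{bmatrix}A&B\\0&0\end{bmatrix}\right)\le\frac{1}{2^{\frac2p-1}}\Big(w_p^p(A)+\frac{1}{2^{p-1}}\|B\|_p^p\Big)^{1/p}.$$
   Context: For $p\in[1,\infty)$, $\|\cdot\|_p$ denotes the Schatten $p$-norm on $M_m(\mathbb{C})$, $\|Y\|_p=(\sum_j s_j(Y)^p)^{1/p}$ with $s_j(Y)$ the singular values of $Y$. The Schatten $p$-generalized numerical radius is $w_p(Y)=\sup_{\theta\in\mathbb{R}}\|\mathrm{Re}(e^{i\theta}Y)\|_p$, where $\mathrm{Re}(Z)=\frac12(Z+Z^* )$. The notation $w_p^p(Y)$ means $(w_p(Y))^p$. Block matrices are elements of $M_{2n}(\mathbb{C})$ with $n\times n$ blocks. *)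

(* Defs.v *)
From HB Require Import structures.
From mathcomp Require Import all_boot all_order all_algebra.
From mathcomp Require Import spectral complex.
From mathcomp Require Import all_classical all_reals all_analysis.

Set Implicit Arguments.
Unset Strict Implicit.
Unset Printing Implicit Defensive.

Import Order.TTheory GRing.Theory Num.Theory.

Local Open Scope ring_scope.
Local Open Scope classical_set_scope.
Local Open Scope sesquilinear_scope.
Local Open Scope complex_scope.

(* The complex numbers are R[i] for an arbitrary realType R. *)

(* The entries of spectral_diag are the eigenvalues of the normal matrix
   Y^* Y, with multiplicity and in no particular order. They are real and
   nonnegative elements of R[i]; complex.Re brings them back to R. *)
Definition singular_value (R : realType) (m : nat) (Y : 'M[R[i]]_m)
  (j : 'I_m) : R :=
  Num.sqrt (complex.Re (spectral_diag (Y^t* *m Y) 0 j)).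

Definition schatten_norm (R : realType) (m : nat) (p : R)
  (Y : 'M[R[i]]_m) : R :=
  (\sum_(j < m) singular_value Y j `^ p) `^ p^-1.

Definition re_mx (R : realType) (m : nat) (Z : 'M[R[i]]_m) : 'M[R[i]]_m :=
  2^-1 *: (Z + Z^t*).

Definition cis (R : realType) (theta : R) : R[i] := cos theta +i* sin theta.

(* The supremum is a genuine one: the set is nonempty and bounded. *)
Definition schatten_numerical_radius (R : realType) (m : nat) (p : R)
  (Y : 'M[R[i]]_m) : R :=
  sup [set schatten_norm p (re_mx (cis theta *: Y)) | theta in [set: R]].

(* Main.v *)
(** Put q = p/2 and S(G) = tr((G^* G)^q), so that the p-th power of the Schatten
    norm of Y is S(Y); it is convenient to let G be rectangular.

    In an orthonormal eigenbasis of X + Y, with X and Y positive semidefinite,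
    convexity of t^q and Peierls' inequality (Jensen with the doubly stochastic
    weights |W_ij|^2 of a unitary W) give
    tr((X + Y)^q) <= 2^(q-1) (tr X^q + tr Y^q). As the Gram matrix of a stack of
    two matrices is the sum of their Gram matrices, this bounds S of a column of
    blocks. Since G^* G and G G^* have the same nonzero eigenvalues, the same
    holds for a row of blocks, so S of a 2 x 2 block matrix is at most 2^(p-2)
    times the sum of S over its blocks. Applied to Re(e^(i theta) T) for
    T = [A B; 0 0], whose off-diagonal blocks are e^(i theta) B / 2 and its
    adjoint, this is (2). On block-diagonal matrices S is additive, and
    Re(e^(i theta) A) = cos(theta) A for Hermitian A, which gives (1). *)

Require Import Defs.
From HB Require Import structures.
From mathcomp Require Import all_boot all_order all_algebra.
From mathcomp Require Import spectral complex.
From mathcomp Require Import all_classical all_reals all_analysis.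
From mathcomp Require Import ring lra.

Set Implicit Arguments.
Unset Strict Implicit.
Unset Printing Implicit Defensive.

Import Order.TTheory GRing.Theory Num.Theory.

Local Open Scope ring_scope.
Local Open Scope sesquilinear_scope.

(** * Convexity inequalities for real powers *)

Lemma powR_jensen (R : realType) (I : finType) (w t : I -> R) (q : R) :
    1 <= q -> (forall i, 0 <= w i) -> \sum_i w i = 1 -> (forall i, 0 <= t i) ->
  (\sum_i w i * t i) `^ q <= \sum_i w i * t i `^ q.
Proof.
(* The case [q = 1] is split off because the conjugate exponent [q / (q - 1)] needs [q > 1]. *)
rewrite le_eqVlt => /predU1P[<-|q1] w0 w1 t0.
  rewrite powRr1; last by apply: sumr_ge0 => i _; rewrite mulr_ge0.
  by apply: ler_sum => i _; rewrite powRr1.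
set a := \sum_i w i * t i.
have a0 : 0 <= a by apply: sumr_ge0 => i _; rewrite mulr_ge0.
have q0 : 0 < q by lra.
have q10 : 0 < q - 1 by lra.
(* Young's inequality is the tangent-line inequality at the mean [a]. *)
have young i : t i * a `^ (q - 1) <= t i `^ q / q + a `^ q * (1 - q^-1).
  have -> : a `^ q * (1 - q^-1) = (a `^ (q - 1)) `^ (q / (q - 1)) / (q / (q - 1)).
    rewrite -powRrM; have -> : (q - 1) * (q / (q - 1)) = q by field; lra.
    by congr (_ * _); field; lra.
  apply: conjugate_powR => //; [exact: powR_ge0|exact: divr_gt0|].
  by field; lra.
rewrite -[leLHS]mul1r -[leRHS]mul1r -(divff (lt0r_neq0 q0)) -!mulrA.
rewrite ler_pM2l// ![q^-1 * _]mulrC.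
have -> : a `^ q / q = a `^ q - a `^ q * (1 - q^-1) by ring.
(* With [a ^ q] written as [a * a ^ (q - 1)], only the linear factor [a] is expanded, so that
   [young] applies term by term. *)
rewrite lerBlDr -{1}mulr_powRB1// {1}/a mulr_suml.
apply: (@le_trans _ _ (\sum_i (w i * t i `^ q / q + w i * (a `^ q * (1 - q^-1))))).
  apply: ler_sum => i _; rewrite -!mulrA -mulrDr ler_wpM2l// ?mulrA ?young//.
by rewrite big_split/= -!mulr_suml w1 mul1r.
Qed.

(** Jensen with two weights 1/2 at [x] and [y], multiplied by [2 ^ q]. *)
Lemma powRD_le (R : realType) (x y q : R) : 1 <= q -> 0 <= x -> 0 <= y ->
  (x + y) `^ q <= 2 `^ (q - 1) * (x `^ q + y `^ q).
Proof.
move=> q1 x0 y0.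
have : (\sum_(b : bool) 2^-1 * (if b then x else y)) `^ q <=
       \sum_(b : bool) 2^-1 * (if b then x else y) `^ q.
  by apply: powR_jensen => // [|[]//]; rewrite big_bool/=; lra.
rewrite !big_bool/= -!mulrDr powRM ?addr_ge0//.
rewrite powRB ?pnatr_eq0 ?implybT// powRr1// -mulrA.
have -> : (2^-1 : R) `^ q = (2 `^ q)^-1.
  by rewrite -powR_inv1// -powRrM mulN1r powRN.
by rewrite ler_pdivrMl ?powR_gt0.
Qed.

(** * Characteristic polynomials and eigenvalue lists *)

(** Both sides are ['X^n * \det M] for the block matrix [M = [X A; B 1]]. Eliminating its lower left
    block by a product on the right leaves the characteristic polynomial of [A *m B]; doing so on
    the left costs a factor ['X^n] and leaves ['X^m] times that of [B *m A]. *)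
Lemma char_poly_mulmxC (F : idomainType) m n (A : 'M[F]_(m, n)) (B : 'M[F]_(n, m)) :
  'X^n * char_poly (A *m B) = 'X^m * char_poly (B *m A).
Proof.
pose a := map_mx polyC A; pose b := map_mx polyC B.
pose M := block_mx ('X%:M : 'M[{poly F}]_m) a b (1%:M : 'M[{poly F}]_n).
have detM : \det M = char_poly (A *m B).
  have : M *m block_mx 1%:M 0 (- b) 1%:M = block_mx (char_poly_mx (A *m B)) a 0 1%:M.
    rewrite mulmx_block !mulmx1 !mulmx0 !mul1mx addrN add0r add0r.
    by rewrite mulmxN /char_poly_mx map_mxM.
  by move/(congr1 determinant); rewrite det_mulmx det_lblock det_ublock !det1 !mulr1.
rewrite -detM.
have : block_mx 1%:M 0 (- b) 'X%:M *m M = block_mx 'X%:M a 0 (char_poly_mx (B *m A)).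
  rewrite mulmx_block !mulmx1 !mul1mx !mul0mx !addr0 mulNmx mul_mx_scalar.
  rewrite mul_scalar_mx addNr mulNmx addrC /char_poly_mx map_mxM.
  by [].
move/(congr1 determinant); rewrite det_mulmx det_lblock det_ublock det1 mul1r.
by rewrite !det_scalar.
Qed.

Lemma char_poly_mulmxC_sq (F : idomainType) n (A B : 'M[F]_n) :
  char_poly (A *m B) = char_poly (B *m A).
Proof.
apply: (mulfI (_ : 'X^n != 0)); last exact: char_poly_mulmxC.
by rewrite monic_neq0 ?monicXn.
Qed.

Lemma char_poly_block_diag (F : comNzRingType) m n (A : 'M[F]_m) (D : 'M[F]_n) :
  char_poly (block_mx A 0 0 D) = char_poly A * char_poly D.
Proof.
rewrite /char_poly -(det_ublock _ 0); congr determinant.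
by rewrite /char_poly_mx map_block_mx !map_mx0 scalar_mx_block opp_block_mx add_block_mx !oppr0 !addr0.
Qed.

Lemma adjmxM (C : numClosedFieldType) k m n (A : 'M[C]_(k, m)) (B : 'M[C]_(m, n)) :
  (A *m B)^t* = B^t* *m A^t*.
Proof. by rewrite trmx_mul map_mxM. Qed.

Lemma adjmxZ (C : numClosedFieldType) m n (c : C) (A : 'M[C]_(m, n)) :
  (c *: A)^t* = c^* *: A^t*.
Proof. by apply/matrixP => i j; rewrite !mxE rmorphM. Qed.

(** A list, so that spectra of matrices of different sizes can be concatenated and compared up to
    permutation. *)
Definition eigenvalues (C : numClosedFieldType) m (M : 'M[C]_m) : seq C :=
  [seq spectral_diag M 0 j | j : 'I_m].

(** Any diagonalization is allowed, not only the one chosen by [spectralmx]; [gram_powsumZ] reuses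
    the eigenbasis of the unscaled matrix. *)
Lemma char_poly_similar_diag (C : numClosedFieldType) m (M P : 'M[C]_m) (d : 'rV[C]_m) :
    P \in unitmx -> M = invmx P *m diag_mx d *m P ->
  char_poly M = \prod_(x <- [seq d 0 j | j : 'I_m]) ('X - x%:P).
Proof.
move=> Pu ->; rewrite char_poly_mulmxC_sq mulmxA mulmxV// mul1mx.
rewrite char_poly_trig ?diag_mx_is_trig// big_map big_enum /=.
by apply: eq_bigr => i _; rewrite mxE eqxx.
Qed.

Lemma char_poly_eigenvalues (C : numClosedFieldType) m (M : 'M[C]_m) :
  M \is normalmx -> char_poly M = \prod_(x <- eigenvalues M) ('X - x%:P).
Proof.
by move=> /orthomx_spectralP; apply: char_poly_similar_diag; exact: spectral_unit.
Qed.

Lemma gram_normal (C : numClosedFieldType) k m (G : 'M[C]_(k, m)) :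
  G^t* *m G \is normalmx.
Proof. by apply/normalmxP; rewrite !adjmxM trmxCK. Qed.

(** * Real parts and positivity of Gram matrices *)

Lemma ReD (R : realType) (x y : R[i]) :
  complex.Re (x + y) = complex.Re x + complex.Re y.
Proof. by case: x y => [a b] [c d]. Qed.

Lemma Re_sum (R : realType) (I : Type) (r : seq I) (P : pred I) (F : I -> R[i]) :
  complex.Re (\sum_(i <- r | P i) F i) = \sum_(i <- r | P i) complex.Re (F i).
Proof. by apply: (big_morph (@complex.Re R)) => //; exact: ReD. Qed.

Lemma Re_ge0 (R : realType) (x : R[i]) : 0 <= x -> 0 <= complex.Re x.
Proof. by rewrite lecE => /andP[]. Qed.

Lemma ReM_ge0 (R : realType) (x y : R[i]) : 0 <= x -> 0 <= y ->
  complex.Re (x * y) = complex.Re x * complex.Re y.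
Proof.
move=> /ger0_Im + /ger0_Im; case: x y => [a b] [c d] /= -> ->.
by rewrite mulr0 subr0.
Qed.

Lemma diag_gram_ge0 (C : numClosedFieldType) k m (G : 'M[C]_(k, m)) i :
  0 <= (G^t* *m G) i i.
Proof. by rewrite mxE sumr_ge0// => j _; rewrite !mxE mulrC mul_conjC_ge0. Qed.

Lemma gram_conj (C : numClosedFieldType) k m n (G : 'M[C]_(k, m)) (Q : 'M[C]_(n, m)) :
  Q *m (G^t* *m G) *m Q^t* = (G *m Q^t*)^t* *m (G *m Q^t*).
Proof. by rewrite adjmxM trmxCK !mulmxA. Qed.

Lemma spectral_diagE (C : numClosedFieldType) m (M : 'M[C]_m) : M \is normalmx ->
  diag_mx (spectral_diag M) = spectralmx M *m M *m (spectralmx M)^t*.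
Proof.
move=> /orthomx_spectralP h; rewrite [in X in _ *m X *m _]h.
rewrite !mulmxA mulmxV ?spectral_unit// mul1mx -mulmxA.
by rewrite (unitarymxP _) ?spectral_unitarymx// mulmx1.
Qed.

Lemma eigenvalues_gram_ge0 (C : numClosedFieldType) k m (G : 'M[C]_(k, m)) j :
  0 <= spectral_diag (G^t* *m G) 0 j.
Proof.
have /matrixP/(_ j j) := spectral_diagE (gram_normal G).
by rewrite mxE eqxx mulr1n => ->; rewrite gram_conj diag_gram_ge0.
Qed.

(** * Power sums of the eigenvalues of Gram matrices *)

(** This is the functional S(G), with exponent [q]. *)
Definition gram_powsum (R : realType) (q : R) k m (G : 'M[R[i]]_(k, m)) : R :=
  \sum_(x <- eigenvalues (G^t* *m G)) complex.Re x `^ q.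

Lemma gram_powsumE (R : realType) (q : R) k m (G : 'M[R[i]]_(k, m)) :
  gram_powsum q G = \sum_j complex.Re (spectral_diag (G^t* *m G) 0 j) `^ q.
Proof. by rewrite /gram_powsum big_map big_enum. Qed.

Lemma gram_powsum_ge0 (R : realType) (q : R) k m (G : 'M[R[i]]_(k, m)) :
  0 <= gram_powsum q G.
Proof. by apply: sumr_ge0 => i _; exact: powR_ge0. Qed.

(** The diagonal entries are averages of the eigenvalues with weights [w i j]. Unit row sums allow
    Jensen in each row; after exchanging the sums, unit column sums make the weights disappear. *)
Lemma peierls (R : realType) (q : R) k m (G : 'M[R[i]]_(k, m)) (Q : 'M[R[i]]_m) :
    1 <= q -> Q \is unitarymx ->
  \sum_i complex.Re ((Q *m (G^t* *m G) *m Q^t*) i i) `^ q <= gram_powsum q G.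
Proof.
move=> q1 Qu; rewrite gram_powsumE.
set M := G^t* *m G; set d := spectral_diag M; set P := spectralmx M.
have Pu : P \is unitarymx by exact: spectral_unitarymx.
pose W := Q *m P^t*.
have Wu : W \is unitarymx by rewrite mul_unitarymx// trmxC_unitary.
have QMQ : Q *m M *m Q^t* = W *m diag_mx d *m W^t*.
  have /orthomx_spectralP := gram_normal G; rewrite -/M -/P -/d => ->.
  by rewrite invmx_unitary// /W adjmxM trmxCK !mulmxA.
pose w i j := complex.Re (W i j * (W i j)^*).
have w_ge0 i j : 0 <= w i j by rewrite Re_ge0// mul_conjC_ge0.
have row1 i : \sum_j w i j = 1.
  rewrite -Re_sum; have /unitarymxP/matrixP/(_ i i) := Wu.
  rewrite !mxE eqxx mulr1n => h.
  suff -> : \sum_j W i j * (W i j)^* = 1 by [].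
  by rewrite -h; apply: eq_bigr => j _; rewrite !mxE.
have col1 j : \sum_i w i j = 1.
  rewrite -Re_sum; have : W^t* \is unitarymx by rewrite trmxC_unitary.
  move=> /unitarymxP/matrixP/(_ j j).
  rewrite !mxE eqxx mulr1n trmxCK => h.
  suff -> : \sum_i W i j * (W i j)^* = 1 by [].
  by rewrite -h; apply: eq_bigr => i _; rewrite !mxE mulrC.
have diagE i : complex.Re ((Q *m M *m Q^t*) i i) =
    \sum_j w i j * complex.Re (d 0 j).
  rewrite QMQ mxE Re_sum; apply: eq_bigr => j _.
  rewrite -ReM_ge0 ?mul_conjC_ge0 ?eigenvalues_gram_ge0//.
  by rewrite mul_mx_diag !mxE mulrAC.
under eq_bigr do rewrite diagE.
apply: (@le_trans _ _ (\sum_i \sum_j w i j * complex.Re (d 0 j) `^ q)).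
  apply: ler_sum => i _; apply: powR_jensen => // j.
  by rewrite Re_ge0// eigenvalues_gram_ge0.
rewrite exchange_big/=; apply: ler_sum => j _.
by rewrite -mulr_suml col1 mul1r.
Qed.

Lemma gram_powsum_col (R : realType) (q : R) k l m (G : 'M[R[i]]_(k, m))
    (H : 'M[R[i]]_(l, m)) : 1 <= q ->
  gram_powsum q (col_mx G H) <= 2 `^ (q - 1) * (gram_powsum q G + gram_powsum q H).
Proof.
move=> q1; set T := col_mx G H; set P := spectralmx (T^t* *m T).
have Pu : P \is unitarymx by exact: spectral_unitarymx.
have TE : T^t* *m T = G^t* *m G + H^t* *m H.
  by rewrite /T tr_col_mx map_row_mx mul_row_col.
apply: (@le_trans _ _ (2 `^ (q - 1) *
   (\sum_i complex.Re ((P *m (G^t* *m G) *m P^t*) i i) `^ q +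
    \sum_i complex.Re ((P *m (H^t* *m H) *m P^t*) i i) `^ q))); last first.
  by rewrite ler_wpM2l ?powR_ge0// lerD// peierls.
(* In the eigenbasis [P], each eigenvalue of [T^t* *m T] is a diagonal entry coming from [G] plus
   one coming from [H]. *)
rewrite gram_powsumE -big_split mulr_sumr; apply: ler_sum => i _ /=.
have /matrixP/(_ i i) := spectral_diagE (gram_normal T).
rewrite mxE eqxx mulr1n -/P TE => ->.
rewrite mulmxDr mulmxDl mxE ReD.
by apply: powRD_le => //; rewrite gram_conj Re_ge0// diag_gram_ge0.
Qed.

(** The two spectra agree once padded with [m] and [k] zeros, the roots of the powers of ['X] in
    [char_poly_mulmxC]. The padding adds nothing to the sums, as 0 to the power [q] vanishes for
    [q != 0]. *)
Lemma gram_powsum_adj (R : realType) (q : R) k m (G : 'M[R[i]]_(k, m)) :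
  q != 0 -> gram_powsum q (G^t*) = gram_powsum q G.
Proof.
move=> q0; rewrite /gram_powsum trmxCK.
have GGn : G *m G^t* \is normalmx by rewrite -{1}[G]trmxCK gram_normal.
have XE l : 'X^l = \prod_(x <- nseq l (0 : R[i])) ('X - x%:P).
  by rewrite big_nseq subr0 iter_mulr_1.
have := char_poly_mulmxC G (G^t*).
rewrite !char_poly_eigenvalues ?gram_normal// !XE -!big_cat/=.
move=> /prod_XsubC_eq eigE.
have : \sum_(x <- nseq m 0 ++ eigenvalues (G *m G^t*)) complex.Re x `^ q =
    \sum_(x <- nseq k 0 ++ eigenvalues (G^t* *m G)) complex.Re x `^ q.
  exact: perm_big.
by rewrite !big_cat/= !big_nseq !powR0// !iter_addr_0 !mul0rn !add0r.
Qed.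

Lemma gram_powsum_row (R : realType) (q : R) k m n (G : 'M[R[i]]_(k, m))
    (H : 'M[R[i]]_(k, n)) : 1 <= q ->
  gram_powsum q (row_mx G H) <= 2 `^ (q - 1) * (gram_powsum q G + gram_powsum q H).
Proof.
move=> q1; have q0 : q != 0 by lra.
rewrite -(gram_powsum_adj (row_mx G H))// -(gram_powsum_adj G)// -(gram_powsum_adj H)//.
rewrite tr_row_mx map_col_mx.
exact: gram_powsum_col.
Qed.

Lemma gram_powsum_block (R : realType) (q : R) k l m n (A : 'M[R[i]]_(k, m))
    (B : 'M[R[i]]_(k, n)) (C : 'M[R[i]]_(l, m)) (D : 'M[R[i]]_(l, n)) : 1 <= q ->
  gram_powsum q (block_mx A B C D) <=
    2 `^ (2 * q - 2) * (gram_powsum q A + gram_powsum q B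
                        + (gram_powsum q C + gram_powsum q D)).
Proof.
move=> q1; apply: le_trans (gram_powsum_col _ _ q1) _.
have -> : 2 * q - 2 = (q - 1) + (q - 1) by ring.
rewrite (@powRD _ 2 (q - 1) (q - 1)) ?pnatr_eq0 ?implybT// -mulrA ler_wpM2l ?powR_ge0// mulrDr.
by rewrite lerD ?gram_powsum_row.
Qed.

(** The characteristic polynomial of the Gram matrix factors, so its spectrum is the concatenation
    of the two spectra. *)
Lemma gram_powsum_block_diag (R : realType) (q : R) k l m n (A : 'M[R[i]]_(k, m))
    (D : 'M[R[i]]_(l, n)) :
  gram_powsum q (block_mx A 0 0 D) = gram_powsum q A + gram_powsum q D.
Proof.
have gramE : (block_mx A 0 0 D)^t* *m block_mx A 0 0 D =
    block_mx (A^t* *m A) 0 0 (D^t* *m D).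
  rewrite tr_block_mx map_block_mx mulmx_block !trmx0 !map_mx0.
  by rewrite !mul0mx !mulmx0 !addr0 !add0r.
rewrite /gram_powsum -big_cat; apply/perm_big/prod_XsubC_eq.
rewrite big_cat -!char_poly_eigenvalues ?gram_normal//.
by rewrite gramE char_poly_block_diag.
Qed.

Lemma gram_powsumZ (R : realType) (q : R) k m (c : R[i]) (G : 'M[R[i]]_(k, m)) :
  gram_powsum q (c *: G) = complex.Re (c * c^*) `^ q * gram_powsum q G.
Proof.
set M := G^t* *m G; pose d := (c * c^*) *: spectral_diag M.
have gramE : (c *: G)^t* *m (c *: G) =
    invmx (spectralmx M) *m diag_mx d *m spectralmx M.
  have /orthomx_spectralP := gram_normal G; rewrite -/M => ME.
  rewrite adjmxZ -scalemxAl -scalemxAr scalerA -/M [in LHS]ME.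
  by rewrite /d linearZ/= -scalemxAr -scalemxAl [_^* * _]mulrC.
have /prod_XsubC_eq dE :
    \prod_(x <- eigenvalues ((c *: G)^t* *m (c *: G))) ('X - x%:P) =
    \prod_(x <- [seq d 0 j | j : 'I_m]) ('X - x%:P).
  rewrite -char_poly_eigenvalues ?gram_normal//.
  by apply: char_poly_similar_diag gramE; exact: spectral_unit.
rewrite /gram_powsum (perm_big _ dE) big_map big_enum /= big_map big_enum mulr_sumr.
apply: eq_bigr => j _; rewrite mxE.
by rewrite ReM_ge0 ?mul_conjC_ge0 ?powRM ?Re_ge0 ?mul_conjC_ge0 ?eigenvalues_gram_ge0.
Qed.

Lemma gram_powsum0 (R : realType) (q : R) k m : q != 0 ->
  gram_powsum q (0 : 'M[R[i]]_(k, m)) = 0.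
Proof. by move=> q0; rewrite -(scale0r 0) gram_powsumZ mul0r powR0// mul0r. Qed.

(** Each eigenvalue is at most the trace, all being nonnegative. This crude bound serves to show
    that the suprema are finite. *)
Lemma gram_powsum_le_trace (R : realType) (q : R) k m (G : 'M[R[i]]_(k, m)) :
  0 <= q -> gram_powsum q G <= m%:R * complex.Re (\tr (G^t* *m G)) `^ q.
Proof.
move=> q0; rewrite gram_powsumE mulr_natl -[X in _ *+ X](card_ord m) -sumr_const.
apply: ler_sum => j _.
have d0 i := Re_ge0 (eigenvalues_gram_ge0 G i).
have -> : \tr (G^t* *m G) = \sum_i spectral_diag (G^t* *m G) 0 i.
  rewrite -mxtrace_diag spectral_diagE ?gram_normal// [RHS]mxtrace_mulC !mulmxA.
  by rewrite -(invmx_unitary (spectral_unitarymx (G^t* *m G))) mulVmx ?mul1mx ?spectral_unit.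
rewrite Re_sum ge0_ler_powR ?nnegrE ?sumr_ge0//.
by rewrite (bigD1 j)//= lerDl sumr_ge0.
Qed.

(** * Schatten norms and numerical radii through power sums *)

Lemma schatten_norm_powsum (R : realType) (p : R) m (Y : 'M[R[i]]_m) :
  schatten_norm p Y = gram_powsum (p / 2) Y `^ p^-1.
Proof.
rewrite /schatten_norm gram_powsumE; congr (_ `^ _).
apply: eq_bigr => j _; rewrite /singular_value.
by rewrite -powR12_sqrt ?Re_ge0 ?eigenvalues_gram_ge0// -powRrM mulrC.
Qed.

Lemma powRVK (R : realType) (p x : R) : p != 0 -> 0 <= x -> (x `^ p^-1) `^ p = x.
Proof. by move=> p0 x0; rewrite -powRrM mulVf// powRr1. Qed.

Lemma normc_cis (R : realType) (theta : R) : `|cis theta| = 1.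
Proof. by rewrite normc_def /= cos2Dsin2 sqrtr1. Qed.

(** Since [cis theta] has modulus 1, each entry of the real part is bounded by [c i j], which does
    not depend on [theta]; the trace of the Gram matrix is the sum of the squared moduli of the
    entries. *)
Lemma re_mx_cis_bounded (R : realType) (q : R) m (A : 'M[R[i]]_m) : 0 <= q ->
  exists K, forall theta, gram_powsum q (re_mx (cis theta *: A)) <= K.
Proof.
move=> q0; pose c i j := 2^-1 * (`|A i j| + `|A j i|) : R[i].
exists (m%:R * (\sum_j \sum_i complex.Re (c i j ^+ 2)) `^ q) => theta.
apply: le_trans (gram_powsum_le_trace _ q0) _; rewrite ler_wpM2l//.
set Y := re_mx _.
have Re_tr : complex.Re (\tr (Y^t* *m Y)) =
    \sum_j \sum_i complex.Re (`|Y i j| ^+ 2).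
  rewrite Re_sum; apply: eq_bigr => j _; rewrite mxE Re_sum.
  by apply: eq_bigr => i _; rewrite !mxE normCKC.
have norm0 (x : R[i]) : 0 <= complex.Re (`|x| ^+ 2) by rewrite Re_ge0// exprn_ge0.
have Yc i j : complex.Re (`|Y i j| ^+ 2) <= complex.Re (c i j ^+ 2).
  have : `|Y i j| ^+ 2 <= c i j ^+ 2.
    rewrite lerXn2r ?nnegrE ?mulr_ge0 ?addr_ge0 ?invr_ge0//.
    rewrite !mxE normrM ger0_norm ?invr_ge0// ler_wpM2l ?invr_ge0//.
    apply: le_trans (ler_normD _ _) _.
    by rewrite norm_conjC !normrM !normc_cis !mul1r.
  by rewrite lecE => /andP[].
rewrite Re_tr ge0_ler_powR ?nnegrE//.
- by do 2![apply: sumr_ge0 => ? _].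
- by do 2![apply: sumr_ge0 => ? _]; exact: le_trans (Yc _ _).
- by do 2![apply: ler_sum => ? _].
Qed.

Lemma schatten_norm_le_numerical_radius (R : realType) (p : R) m
    (A : 'M[R[i]]_m) theta : 0 < p ->
  schatten_norm p (re_mx (cis theta *: A)) <= schatten_numerical_radius p A.
Proof.
move=> p0; apply: ub_le_sup; last by exists theta.
have [|K KP] := @re_mx_cis_bounded R (p / 2) m A; first by rewrite divr_ge0// ltW.
exists (K `^ p^-1) => _ [t _ <-]; rewrite schatten_norm_powsum.
have K_ge0 : 0 <= K := le_trans (gram_powsum_ge0 _ _) (KP t).
by rewrite ge0_ler_powR ?nnegrE ?invr_ge0 ?gram_powsum_ge0// ltW.
Qed.

Lemma powsum_le_numerical_radius (R : realType) (p : R) m (A : 'M[R[i]]_m) theta :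
    0 < p ->
  gram_powsum (p / 2) (re_mx (cis theta *: A)) <= schatten_numerical_radius p A `^ p.
Proof.
move=> p0; have h := schatten_norm_le_numerical_radius A theta p0.
have norm_ge0 : 0 <= schatten_norm p (re_mx (cis theta *: A)) by exact: powR_ge0.
rewrite -[leLHS](@powRVK _ p) ?gram_powsum_ge0 ?gt_eqF// -schatten_norm_powsum.
by rewrite ge0_ler_powR ?nnegrE ?(le_trans norm_ge0 h)// ltW.
Qed.

Lemma numerical_radius_le (R : realType) (p K : R) m (A : 'M[R[i]]_m) : 0 < p ->
    (forall theta, gram_powsum (p / 2) (re_mx (cis theta *: A)) <= K) ->
  schatten_numerical_radius p A <= K `^ p^-1.
Proof.
move=> p0 KP; apply: ge_sup.
  by exists (schatten_norm p (re_mx (cis 0 *: A))); exists 0.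
move=> _ [t _ <-]; rewrite schatten_norm_powsum.
have K_ge0 : 0 <= K := le_trans (gram_powsum_ge0 _ _) (KP t).
by rewrite ge0_ler_powR ?nnegrE ?invr_ge0 ?gram_powsum_ge0// ltW.
Qed.

Lemma re_mx_cis_hermitian (R : realType) m (A : 'M[R[i]]_m) theta : A \is hermsymmx ->
  re_mx (cis theta *: A) = (cos theta)%:C%C *: A.
Proof.
move=> /is_hermitianmxP; rewrite expr0 scale1r => AE.
rewrite /re_mx adjmxZ -AE -scalerDl scalerA.
congr (_ *: _).
by rewrite [cis theta + _]addcJ mulKf// pnatr_eq0.
Qed.

(** The factor [cos theta] can only shrink the power sum, and [theta = 0] attains the supremum. *)
Lemma numerical_radius_hermitian (R : realType) (p : R) m (A : 'M[R[i]]_m) : 0 < p ->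
  A \is hermsymmx -> schatten_numerical_radius p A = gram_powsum (p / 2) A `^ p^-1.
Proof.
move=> p0 Ah.
have re0 : re_mx (cis 0 *: A) = A by rewrite re_mx_cis_hermitian// cos0 scale1r.
apply/eqP; rewrite eq_le; apply/andP; split.
  apply: numerical_radius_le => // theta.
  rewrite re_mx_cis_hermitian// gram_powsumZ.
  rewrite ler_piMl ?gram_powsum_ge0//.
  have -> : complex.Re ((cos theta)%:C%C * ((cos theta)%:C%C)^*) = cos theta ^+ 2.
    by rewrite /= mul0r subr0 expr2.
  have one_powR : 1 `^ (p / 2) = 1 :> R by rewrite powR1.
  rewrite -[leRHS]one_powR ge0_ler_powR ?nnegrE ?sqr_ge0//.
  by rewrite divr_ge0// ltW.
rewrite -{1}re0 -schatten_norm_powsum.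
exact: schatten_norm_le_numerical_radius.
Qed.

Lemma re_mx_block (R : realType) m n (A : 'M[R[i]]_m) (B : 'M[R[i]]_(m, n))
    (C : 'M[R[i]]_(n, m)) (D : 'M[R[i]]_n) :
  re_mx (block_mx A B C D) =
    block_mx (re_mx A) (2^-1 *: (B + C^t*)) (2^-1 *: (C + B^t*)) (re_mx D).
Proof.
by rewrite /re_mx tr_block_mx map_block_mx add_block_mx scale_block_mx.
Qed.

Theorem mainTheorem9 (R : realType) (n : nat) (p : R) (hp : 2 <= p)
    (A B D : 'M[R[i]]_n) :
  [/\ schatten_numerical_radius p (block_mx A 0 0 D)
        <= (2 `^ (2 / p - 1))^-1
           * (schatten_numerical_radius p A `^ p
              + schatten_numerical_radius p D `^ p) `^ p^-1,
      (A \is hermsymmx -> D \is hermsymmx ->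
       schatten_numerical_radius p (block_mx A 0 0 D)
         = (schatten_numerical_radius p A `^ p
            + schatten_numerical_radius p D `^ p) `^ p^-1)
    & schatten_numerical_radius p (block_mx A B 0 0)
        <= (2 `^ (2 / p - 1))^-1
           * (schatten_numerical_radius p A `^ p
              + (2 `^ (p - 1))^-1 * schatten_norm p B `^ p) `^ p^-1].
Proof.
have p0 : 0 < p by lra.
have pN0 : p != 0 by rewrite gt_eqF.
have q1 : 1 <= p / 2 by lra.
have qN0 : p / 2 != 0 by lra.
split.
(* The bound holds with constant 1, and the stated constant is at least 1 because
   [2 / p - 1 <= 0]. *)
- apply: (@le_trans _ _ ((schatten_numerical_radius p A `^ p
    + schatten_numerical_radius p D `^ p) `^ p^-1)).
    apply: numerical_radius_le => // theta.
    rewrite scale_block_mx !scaler0 re_mx_block trmx0 map_mx0 addr0 scaler0.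
    by rewrite gram_powsum_block_diag lerD ?powsum_le_numerical_radius.
  rewrite ler_peMl ?powR_ge0// -powRN -[leLHS](powRr0 2) ler_powR ?ler1n//.
  by rewrite opprB subr_ge0 ler_pdivrMr// mul1r.
- move=> Ah Dh.
  rewrite !numerical_radius_hermitian//.
    by rewrite gram_powsum_block_diag !powRVK ?gram_powsum_ge0.
  (* It remains to see that the block matrix is itself Hermitian. *)
  move: Ah Dh => /is_hermitianmxP + /is_hermitianmxP.
  rewrite !expr0 !scale1r => AE DE; apply/is_hermitianmxP.
  by rewrite expr0 scale1r tr_block_mx map_block_mx !trmx0 !map_mx0 -AE -DE.
(* Under the root the constant becomes [2 ^ (p - 2)], the factor given by [gram_powsum_block] at
   [q = p / 2]. *)
- have -> : (2 `^ (2 / p - 1))^-1 = (2 `^ (p - 2)) `^ p^-1 :> R.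
    by rewrite -powRN -powRrM; congr (_ `^ _); field.
  rewrite -powRM ?addr_ge0 ?mulr_ge0 ?invr_ge0 ?powR_ge0//.
  apply: numerical_radius_le => // theta.
  rewrite scale_block_mx !scaler0 re_mx_block trmx0 map_mx0 addr0 add0r.
  apply: le_trans (gram_powsum_block _ _ _ _ q1) _.
  have -> : 2 * (p / 2) - 2 = p - 2 by field.
  rewrite ler_wpM2l ?powR_ge0// [re_mx 0]/re_mx trmx0 map_mx0 addr0 scaler0.
  rewrite gram_powsum0// addr0 -addrA lerD ?powsum_le_numerical_radius//.
  (* The lower left block is the adjoint of the upper right one, so both contribute the same power
     sum. *)
  have -> : 2^-1 *: (cis theta *: B)^t* = (2^-1 *: (cis theta *: B))^t*.
    by rewrite [RHS]adjmxZ geC0_conj ?invr_ge0.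
  rewrite gram_powsum_adj// scalerA gram_powsumZ.
  rewrite schatten_norm_powsum powRVK ?gram_powsum_ge0//.
  rewrite -mulrDl ler_wpM2r ?gram_powsum_ge0//.
  have -> : complex.Re (2^-1 * cis theta * (2^-1 * cis theta)^*) = 2 `^ (-2).
    rewrite -normCK normrM normc_cis mulr1 ger0_norm ?invr_ge0//.
    have -> : 2^-1 = (2^-1)%:C%C :> R[i] by rewrite fmorphV rmorph_nat.
    by rewrite -rmorphXn/= exprVn powR_invn.
  (* The two off-diagonal blocks carry the coefficient [2 * (2 ^ (-2)) ^ (p / 2)], which equals
     [2 ^ (1 - p)]. *)
  rewrite -[leLHS]mulr2n -[leLHS]mulr_natl -powRrM -powRN.
  rewrite -[X in X * _]powRr1// -powRD ?pnatr_eq0 ?implybT//.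
  by rewrite ler_powR ?ler1n//; lra.
Qed.
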